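(* Let $(X,S)$ be an association scheme, and let $H$ and $T$ be closed subsets of $S$ such that $H \subseteq T$ and $T$ is strongly normal in $S$. Assume that the following conditions are satisfied: (i) $sH=sT$ for each $s \in S \setminus T$; (ii) $tH=\{t\}$ for each $t \in T \setminus H$. Then, for each $\iota \in \mathrm{Aut}(T)$ fixing each element of $H$, we have $\tilde{\iota} \in \mathrm{Aut}(S)$, where $\tilde\iota: S\to S$ is defined by $s^{\tilde{\iota}} = s$ if $s \in S \setminus T$ and $s^{\tilde{\iota}}= s^{\iota}$ if $s \in T$.
   Context: An association scheme $(X,S)$ consists of a non-empty finite set $X$ and a partition $S$ of $X\times X$ such that: (i) $1_X:=\{(x,x)\mid x\in X\}\in S$; (ii) for each $s\in S$, $s^*:=\{(x,y)\mid (y,x)\in s\}\in S$; (iii) for all $s,t,u\in S$ the number $c_{st}^u:=|xs\cap yt^*|$ is constant whenever $(x,y)\in u$, where $xs:=\{y\in X\mid (x,y)\in s\}$. The $c_{st}^u$ are the intersection numbers. For non-empty $P,Q\subseteq S$, the complex product $PQ$ is the set of all $s\in S$ such that $c_{pq}^s\neq 0$ for some $p\in P$, $q\in Q$; a singleton $\{s\}$ in a complex product is written $s$. A non-empty subset $T\subseteq S$ is closed if $TT\subseteq T$. A closed subset $T$ is strongly normal in $S$ if $s^*Ts\subseteq T$ for every $s\in S$. For a closed subset $T$ of $S$ (including $T=S$), $\mathrm{Aut}(T)=\{\iota\in\mathrm{Sym}(T)\mid c_{rs}^t=c_{r^\iota s^\iota}^{t^\iota}\text{ for all }r,s,t\in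 T\}$. *)

(* Defs.v *)
From mathcomp Require Import all_boot.

Set Implicit Arguments.
Unset Strict Implicit.
Unset Printing Implicit Defensive.

Section AssociationSchemes.

Variable X : finType.

(* A relation on X is a set of pairs. *)
Local Notation rl := {set X * X}.
Implicit Types (s t u : rl) (S H T P Q : {set rl}).

Definition diag_rel : rl := [set p : X * X | p.1 == p.2].

Definition conv_rel s : rl := [set p : X * X | (p.2, p.1) \in s].

(* The set xs. *)
Definition nbrs (x : X) s : {set X} := [set y | (x, y) \in s].

Record is_scheme S : Prop := IsScheme {
  scheme_nonempty : 0 < #|X|;
  scheme_partition : partition S [set: X * X];
  scheme_diag : diag_rel \in S;
  scheme_conv : {in S, forall s, conv_rel s \in S};
  scheme_regular : forall s t u, s \in S -> t \in S -> u \in S ->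
    forall x y x' y', (x, y) \in u -> (x', y') \in u ->
      #|nbrs x s :&: nbrs y (conv_rel t)| =
      #|nbrs x' s :&: nbrs y' (conv_rel t)|
}.

(* c_{st}^u, computed at a chosen pair of u; by inumE below, in a scheme
   the choice is irrelevant. *)
Definition inum s t u : nat :=
  if [pick p in u] is Some p
  then #|nbrs p.1 s :&: nbrs p.2 (conv_rel t)| else 0.

Lemma inumE S s t u x y : is_scheme S -> s \in S -> t \in S -> u \in S ->
  (x, y) \in u -> inum s t u = #|nbrs x s :&: nbrs y (conv_rel t)|.
Proof.
move=> schS sS tS uS xy_u; rewrite /inum.
case: pickP => [[x' y'] xy'_u | /(_ (x, y))]; last by rewrite xy_u.
exact: (scheme_regular schS sS tS uS).
Qed.

(* The complex product PQ of subsets P, Q of S. *)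
Definition cprod S P Q : {set rl} :=
  [set s in S | [exists p in P, exists q in Q, inum p q s != 0]].

Definition closed_subset S T : Prop :=
  [/\ T \subset S, T != set0 & cprod S T T \subset T].

Definition strongly_normal S T : Prop :=
  closed_subset S T /\
  {in S, forall s, cprod S (cprod S [set conv_rel s] T) [set s] \subset T}.

(* Elements of Sym(T) are represented by functions on all relations, of which
   only the restriction to T matters. *)
Definition sym_on T (f : rl -> rl) : Prop :=
  {in T &, injective f} /\ f @: T = T.

Definition scheme_aut T (f : rl -> rl) : Prop :=
  sym_on T f /\
  {in T & T & T, forall r s t, inum r s t = inum (f r) (f s) (f t)}.

Definition tilde T (f : rl -> rl) : rl -> rl :=
  fun s => if s \in T then f s else s.

End AssociationSchemes.

(* Main.v *)
Require Import Defs.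
From mathcomp Require Import all_boot.

Set Implicit Arguments.
Unset Strict Implicit.
Unset Printing Implicit Defensive.

(** Only the numbers [c_rs^t] with exactly two of [r], [s], [t] outside [T] need
an argument.  Let [(x, y)] be in [t].  If [r] is outside [T], [s] lies in
[T \ H], and [t] lies in [rT = rH], then [x r] meets each [H]-class of the
[T]-class of [y] in a constant number [m] of points, while [y s^*] is a union of
[H]-classes; counting pairs gives [n_H c_rs^t = m n_{s^*}], whose right-hand
side depends on [s] only through a valency, which [iota] preserves.  The other
two positions of the element of [T] follow from
[c_rs^t = c_{s^* r^*}^{t^*}] and [n_t c_rs^t = n_r c_{t s^*}^r]. *)

Section Schemes.

Context {X : finType}.
Implicit Types (s t u : {set X * X}) (T P Q : {set {set X * X}}).

(** * Relations as blocks of pairs, and complex products in terms of points *)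

Lemma conv_relE s (x y : X) : ((x, y) \in conv_rel s) = ((y, x) \in s).
Proof. by rewrite inE. Qed.

Lemma conv_relK : involutive (@conv_rel X).
Proof. by move=> s; apply/setP=> -[x y]; rewrite !conv_relE. Qed.

Lemma nbrsE s (x y : X) : (y \in nbrs x s) = ((x, y) \in s).
Proof. by rewrite inE. Qed.

Lemma diag_relE (x y : X) : ((x, y) \in diag_rel X) = (x == y).
Proof. by rewrite inE. Qed.

Context {S : {set {set X * X}}} (schS : is_scheme S).

Lemma scheme_rel_inj s t p :
  s \in S -> t \in S -> p \in s -> p \in t -> s = t.
Proof.
have /and3P[_ tiS _] := scheme_partition schS.
by move=> sS tS ps pt; rewrite -(def_pblock tiS sS ps) (def_pblock tiS tS pt).
Qed.

Lemma scheme_rel_ex p : exists2 s, s \in S & p \in s.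
Proof.
have /and3P[/eqP covS _ _] := scheme_partition schS.
have pS: p \in cover S by rewrite covS inE.
by exists (pblock S p); [apply: pblock_mem | rewrite mem_pblock].
Qed.

Lemma scheme_rel_nonempty s : s \in S -> exists x y, (x, y) \in s.
Proof.
have /and3P[_ _ S0] := scheme_partition schS.
move=> sS; have /set0Pn[[x y] xy]: s != set0 by apply: contraNneq S0 => <-.
by exists x, y.
Qed.

(** This lemma, [mem_cprod] and [cprod_link] trade intersection numbers and complex products for
    two-step paths of points, on which the later arguments run. *)
Lemma inum_neq0P s t u x y : s \in S -> t \in S -> u \in S -> (x, y) \in u ->
  reflect (exists2 z, (x, z) \in s & (z, y) \in t) (inum s t u != 0).
Proof.
move=> sS tS uS xyu; rewrite (inumE schS sS tS uS xyu) cards_eq0.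
apply: (iffP (set0Pn _)) => [[z]|[z xz zy]].
  by rewrite inE !nbrsE conv_relE => /andP[]; exists z.
by exists z; rewrite inE !nbrsE conv_relE xz.
Qed.

Lemma mem_cprod P Q u x y z p q : P \subset S -> Q \subset S -> u \in S ->
  p \in P -> q \in Q -> (x, z) \in p -> (z, y) \in q -> (x, y) \in u ->
  u \in cprod S P Q.
Proof.
move=> PS QS uS pP qQ xz zy xy; rewrite inE uS /=.
apply/existsP; exists p; rewrite pP /=; apply/existsP; exists q; rewrite qQ /=.
apply/(inum_neq0P (subsetP PS _ pP) (subsetP QS _ qQ) uS xy).
by exists z.
Qed.

Lemma cprod_link P Q u x y : P \subset S -> Q \subset S ->
  u \in cprod S P Q -> (x, y) \in u ->
  exists z p q, [/\ p \in P, q \in Q, (x, z) \in p & (z, y) \in q].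
Proof.
move=> PS QS; rewrite inE => /andP[uS /existsP[p /andP[pP]]].
case/existsP=> q /andP[qQ neq0] xy.
case/(inum_neq0P (subsetP PS _ pP) (subsetP QS _ qQ) uS xy): neq0 => z xz zy.
by exists z, p, q.
Qed.

(** * Valencies and counting identities *)

Definition valency s := inum s (conv_rel s) (diag_rel X).

Lemma valencyE s x : s \in S -> #|nbrs x s| = valency s.
Proof.
move=> sS; rewrite /valency.
rewrite (inumE (x := x) (y := x) schS) ?diag_relE ?conv_relK ?setIid //.
  exact: scheme_conv.
exact: scheme_diag.
Qed.

Lemma valency_gt0 s : s \in S -> 0 < valency s.
Proof.
move=> sS; have [x [y xy]] := scheme_rel_nonempty sS.
by rewrite -(valencyE x) //; apply/card_gt0P; exists y; rewrite nbrsE.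
Qed.

Lemma card_nbrs_cover (A : {set X}) T x : T \subset S ->
  #|A :&: nbrs x (cover T)| = \sum_(t in T) #|A :&: nbrs x t|.
Proof.
move=> TS; have /and3P[_ tiS _] := scheme_partition schS.
(* Each point [z] is sorted by the unique block of [S] that contains [(x, z)]. *)
rewrite -sum1_card (partition_big (fun z => pblock S (x, z)) (mem T)) /=.
  apply: eq_bigr => t tT; rewrite -sum1_card; apply: eq_bigl => z.
  have tS := subsetP TS _ tT.
  rewrite !inE -andbA; congr (_ && _).
  apply/andP/idP => [[/bigcupP[u uT xz] /eqP] | xz].
    by rewrite (def_pblock tiS (subsetP TS _ uT) xz) => <-.
  by rewrite (def_pblock tiS tS xz); split=> //; apply/bigcupP; exists t.
move=> z; rewrite !inE => /andP[_ /bigcupP[u uT xz]].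
by rewrite (def_pblock tiS (subsetP TS _ uT) xz).
Qed.

Lemma valency_cover T x : T \subset S ->
  #|nbrs x (cover T)| = \sum_(t in T) valency t.
Proof.
move=> TS; rewrite -[nbrs x _]setTI card_nbrs_cover //.
by apply: eq_bigr => t tT; rewrite setTI valencyE // (subsetP TS).
Qed.

Lemma inum_conv s t u : s \in S -> t \in S -> u \in S ->
  inum s t u = inum (conv_rel t) (conv_rel s) (conv_rel u).
Proof.
move=> sS tS uS; have [x [y xy]] := scheme_rel_nonempty uS.
rewrite (inumE schS sS tS uS xy) (inumE (x := y) (y := x) schS);
  rewrite ?conv_relE ?conv_relK ?(scheme_conv schS) //.
by rewrite setIC.
Qed.

Lemma double_count (A B : {set X}) (e : rel X) :
  \sum_(a in A) #|[set b in B | e a b]| = \sum_(b in B) #|[set a in A | e a b]|.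
Proof.
transitivity (\sum_(a in A) \sum_(b in B | e a b) 1).
  apply: eq_bigr => a _; rewrite -sum1_card.
  by apply: eq_bigl => b; rewrite inE.
rewrite (exchange_big_dep (mem B)) /=; last by move=> a b _ /andP[].
apply: eq_bigr => b bB; rewrite -sum1_card.
by apply: eq_bigl => a; rewrite inE bB.
Qed.

(** With [x] fixed, count in two ways the pairs of [y] in [nbrs x t] and [z] in [nbrs x r] with
    [(z, y)] in [s]. *)
Lemma valency_inum r s t : r \in S -> s \in S -> t \in S ->
  valency t * inum r s t = valency r * inum t (conv_rel s) r.
Proof.
move=> rS sS tS; have [x _] := scheme_rel_nonempty rS.
have := double_count (nbrs x t) (nbrs x r) (fun y z => (z, y) \in s).
rewrite (eq_bigr (fun=> inum r s t)); last first.
  move=> y; rewrite nbrsE => xy; rewrite (inumE schS rS sS tS xy).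
  by apply: eq_card => z; rewrite !inE.
rewrite [in RHS](eq_bigr (fun=> inum t (conv_rel s) r)); last first.
  move=> z; rewrite nbrsE => xz.
  rewrite (inumE schS tS (scheme_conv schS sS) rS xz).
  by apply: eq_card => y; rewrite !inE.
by rewrite !sum_nat_const !valencyE.
Qed.

(** * Closed subsets as equivalence relations on the points *)

Section Closed.

Context {T : {set {set X * X}}} (clT : closed_subset S T).

Lemma closed_sub : T \subset S. Proof. by case: clT. Qed.

Lemma closed_trans x y z :
  (x, y) \in cover T -> (y, z) \in cover T -> (x, z) \in cover T.
Proof.
case: clT => TS _ /subsetP TT /bigcupP[p pT xy] /bigcupP[q qT yz].
have [u uS xz] := scheme_rel_ex (x, z).
apply/bigcupP; exists u => //; apply: TT.
by apply: (mem_cprod _ _ uS pT qT xy yz).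
Qed.

(* All the sets [nbrs x (cover T)] have the same cardinality, so the inclusion
   given by transitivity is an equality. *)
Lemma closed_nbrs x y : (x, y) \in cover T ->
  nbrs y (cover T) = nbrs x (cover T).
Proof.
move=> xy; apply/eqP; rewrite eqEcard !valency_cover ?closed_sub // leqnn andbT.
by apply/subsetP=> z; rewrite !nbrsE; apply: closed_trans.
Qed.

Lemma closed_mem u x y : u \in S -> (x, y) \in u -> (x, y) \in cover T -> u \in T.
Proof.
move=> uS xyu /bigcupP[t tT xyt].
by rewrite (scheme_rel_inj uS (subsetP closed_sub _ tT) xyu xyt).
Qed.

(** If [T] covers [(x, y)], then [y] lies in the class of [x], which equals that of [y]; hence [T]
    covers [(y, y)]. *)
Lemma closed_diag : diag_rel X \in T.
Proof.
case: clT => TS /set0Pn[t tT] _.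
have [x [y xyt]] := scheme_rel_nonempty (subsetP TS _ tT).
have xy: (x, y) \in cover T by apply/bigcupP; exists t.
apply: (closed_mem (x := y) (y := y)) (scheme_diag schS) _ _.
  by rewrite diag_relE.
by rewrite -nbrsE (closed_nbrs xy) nbrsE.
Qed.

Lemma closed_refl x : (x, x) \in cover T.
Proof. by apply/bigcupP; exists (diag_rel X); rewrite ?closed_diag ?diag_relE. Qed.

Lemma closed_sym x y : (x, y) \in cover T -> (y, x) \in cover T.
Proof. by move=> xy; rewrite -nbrsE (closed_nbrs xy) nbrsE closed_refl. Qed.

Lemma closed_conv t : t \in T -> conv_rel t \in T.
Proof.
move=> tT; have tS := subsetP closed_sub _ tT.
have [x [y xy]] := scheme_rel_nonempty tS.
apply: (closed_mem (x := y) (y := x)); rewrite ?conv_relE ?(scheme_conv schS) //.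
by apply: closed_sym; apply/bigcupP; exists t.
Qed.

Lemma conv_closedE t : (conv_rel t \in T) = (t \in T).
Proof. by apply/idP/idP => /closed_conv //; rewrite conv_relK. Qed.

(** A non-zero number gives a triangle of points with sides in [r], [s], [t]. As [cover T] is an
    equivalence relation, two sides in it force the third. *)
Lemma inum_neq0_closed r s t : r \in S -> s \in S -> t \in S ->
  inum r s t != 0 ->
  [/\ r \in T -> s \in T -> t \in T,
      r \in T -> t \in T -> s \in T & s \in T -> t \in T -> r \in T].
Proof.
move=> rS sS tS; have [x [y xy]] := scheme_rel_nonempty tS.
case/(inum_neq0P rS sS tS xy) => z xz zy.
have lift u a b : u \in T -> (a, b) \in u -> (a, b) \in cover T.
  by move=> uT ab; apply/bigcupP; exists u.
split=> [rT sT | rT tT | sT tT].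
- exact: closed_mem tS xy (closed_trans (lift _ _ _ rT xz) (lift _ _ _ sT zy)).
- apply: closed_mem sS zy (closed_trans (closed_sym _) (lift _ _ _ tT xy)).
  exact: lift rT xz.
- apply: closed_mem rS xz (closed_trans (lift _ _ _ tT xy) (closed_sym _)).
  exact: lift sT zy.
Qed.

End Closed.

(** Both sides count the pairs of [z] in [nbrs y (conv_rel s)] and [v] in [nbrs x r] lying in one
    [H]-class, where [(x, y)] is in [t]. The sum of [inum r (conv_rel h) r] is the number of such
    [v] for any given [z]. *)
Lemma inum_coset H T r s t :
  closed_subset S H -> closed_subset S T ->
  r \in S -> s \in T -> t \in cprod S [set r] T ->
  cprod S [set r] H = cprod S [set r] T ->
  cprod S [set conv_rel s] H = [set conv_rel s] ->
  (\sum_(h in H) valency h) * inum r s t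
    = (\sum_(h in H) inum r (conv_rel h) r) * valency (conv_rel s).
Proof.
move=> clH clT rS sT trT rHT sH.
have [HS TS] := (closed_sub clH, closed_sub clT).
have sS := subsetP TS _ sT; have csS := scheme_conv schS sS.
have r1S: [set r] \subset S by rewrite sub1set.
have cs1S: [set conv_rel s] \subset S by rewrite sub1set.
have tS: t \in S by move: trT; rewrite inE => /andP[].
have [x [y xy]] := scheme_rel_nonempty tS.
have [w [p [q [/set1P-> qT xw wyq]]]] := cprod_link r1S TS trT xy.
have wy: (w, y) \in cover T by apply/bigcupP; exists q.
(* The relation from [x] to [z] is in [rT = rH], so the [H]-class of [z] contains some [v] in
   [nbrs x r]. Seen from [v], that class splits into the sets [nbrs v h'], and [(x, v)] in [r] makes
   each count an intersection number at [r]. *)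
have cosetE z : (z, y) \in s ->
    #|[set v in nbrs x r | (z, v) \in cover H]|
      = \sum_(h in H) inum r (conv_rel h) r.
  move=> zys; have zy: (z, y) \in cover T by apply/bigcupP; exists s.
  have /bigcupP[q' q'T wz] := closed_trans clT wy (closed_sym clT zy).
  have [u uS xz] := scheme_rel_ex (x, z).
  have urH: u \in cprod S [set r] H.
    by rewrite rHT; apply: (mem_cprod _ _ uS (set11 r) q'T xw wz).
  have [v [_ [h [/set1P-> hH xv vzh]]]] := cprod_link r1S HS urH xz.
  have vz: (v, z) \in cover H by apply/bigcupP; exists h.
  transitivity #|nbrs x r :&: nbrs v (cover H)|.
    by rewrite -(closed_nbrs clH vz); apply: eq_card => a; rewrite !inE.
  rewrite card_nbrs_cover //; apply: eq_bigr => h' h'H.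
  have h'S := subsetP HS _ h'H.
  by rewrite (inumE schS rS (scheme_conv schS h'S) rS xv) conv_relK.
have := double_count (nbrs y (conv_rel s)) (nbrs x r)
          (fun z v => (z, v) \in cover H).
rewrite (eq_bigr (fun=> \sum_(h in H) inum r (conv_rel h) r)); last first.
  by move=> z; rewrite nbrsE conv_relE => /cosetE.
rewrite sum_nat_const valencyE // mulnC => ->.
rewrite (inumE schS rS sS tS xy) mulnC -sum_nat_const big_mkcond.
rewrite [RHS]big_mkcond.
(* If [v] is in both neighbourhoods, its whole [H]-class lies in [nbrs y (conv_rel s)] by [sH], so
   it contributes the size of an [H]-class. *)
apply: eq_bigr => v _; rewrite inE; case: ifP => [/andP[-> yv]|xvyv].
  rewrite -(valency_cover v HS); apply/esym/eq_card => z.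
  rewrite !inE; apply/andP/idP => [[_] | vz]; first exact: closed_sym.
  split; last exact: closed_sym.
  rewrite nbrsE conv_relE in yv.
  have [u uS yz] := scheme_rel_ex (y, z); case/bigcupP: vz => h hH vz.
  have: u \in cprod S [set conv_rel s] H.
    apply: (mem_cprod cs1S HS uS (set11 _) hH _ vz yz).
    by rewrite conv_relE.
  by rewrite sH => /set1P us; rewrite us conv_relE in yz.
(* If [v] is only in [nbrs x r], it contributes nothing: a suitable [z] in its [H]-class would, by
   [sH], put [v] into [nbrs y (conv_rel s)] as well. *)
case: ifP => // xv; apply/esym/eqP; rewrite cards_eq0; apply/set0Pn=> -[z].
rewrite !inE => /andP[zys zv]; case/negP: (negbT xvyv); rewrite xv.
rewrite nbrsE conv_relE; have [u uS yv] := scheme_rel_ex (y, v).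
case/bigcupP: zv => h hH zv.
have: u \in cprod S [set conv_rel s] H.
  apply: (mem_cprod cs1S HS uS (set11 _) hH _ zv yv).
  by rewrite conv_relE.
by rewrite sH => /set1P us; rewrite us conv_relE in yv.
Qed.

(** * Automorphisms of a closed subset that fix the diagonal *)

Section Automorphism.

Context {T : {set {set X * X}}} (clT : closed_subset S T).
Context {f : {set X * X} -> {set X * X}} (autf : scheme_aut T f).

Lemma aut_mem s : s \in T -> f s \in T.
Proof. by case: autf => -[_ fT] _ sT; rewrite -fT imset_f. Qed.

Context (f1 : f (diag_rel X) = diag_rel X).

(** Intersection numbers determine the converse: it is the only relation [u] for which
    [inum s u (diag_rel X)] is non-zero. *)
Lemma aut_conv s : s \in T -> f (conv_rel s) = conv_rel (f s).
Proof.
move=> sT; have TS := subsetP (closed_sub clT).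
have csT := closed_conv clT sT; have dT := closed_diag clT.
have [x [y xy]] := scheme_rel_nonempty (TS _ sT).
have dx: (x, x) \in diag_rel X by rewrite diag_relE.
have: inum s (conv_rel s) (diag_rel X) != 0.
  apply/(inum_neq0P (TS _ sT) (TS _ csT) (TS _ dT) dx).
  by exists y; rewrite ?conv_relE.
rewrite (autf.2 _ _ _ sT csT dT) f1.
have fsS := TS _ (aut_mem sT); have fcsS := TS _ (aut_mem csT).
case/(inum_neq0P fsS fcsS (TS _ dT) dx) => z xz zx.
apply: (scheme_rel_inj fcsS (scheme_conv schS fsS) zx).
by rewrite conv_relE.
Qed.

(** The valency is itself an intersection number of [s], its converse and the diagonal, all of which
    [f] respects. *)
Lemma aut_valency s : s \in T -> valency (f s) = valency s.
Proof.
move=> sT; rewrite /valency -aut_conv // -[in LHS]f1 -(autf.2) //.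
- exact: closed_conv.
- exact: closed_diag.
Qed.

End Automorphism.

(** * Extending the automorphism by the identity outside [T] *)

Section Extension.

Context {H T : {set {set X * X}}}.
Context (clH : closed_subset S H) (clT : closed_subset S T) (sHT : H \subset T).
Context (cond_i : forall s, s \in S :\: T ->
  cprod S [set s] H = cprod S [set s] T).
Context (cond_ii : forall t, t \in T :\: H -> cprod S [set t] H = [set t]).
Context {f : {set X * X} -> {set X * X}} (autf : scheme_aut T f).
Context (fixH : forall h, h \in H -> f h = h).

Let f1 : f (diag_rel X) = diag_rel X. Proof. exact: fixH (closed_diag clH). Qed.

Lemma aut_notin s : s \in T -> s \notin H -> f s \notin H.
Proof.
move=> sT; apply: contra => fsH; have fsT := subsetP sHT _ fsH.
by rewrite -(autf.1.1 _ _ fsT sT (fixH fsH)).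
Qed.

Lemma inum_aut_r r s t : r \in S -> r \notin T -> s \in T -> t \in S ->
  inum r (f s) t = inum r s t.
Proof.
move=> rS rT sT tS; have TS := subsetP (closed_sub clT).
have [sH | sH] := boolP (s \in H); first by rewrite fixH.
(* For [t] outside [rT] both numbers vanish, since [s] and [f s] are in [T]. *)
have [trT | trT] := boolP (t \in cprod S [set r] T); last first.
  have inum0 u : u \in T -> inum r u t = 0.
    move=> uT; apply/eqP; apply: contraNT trT => neq0.
    have [x [y xy]] := scheme_rel_nonempty tS.
    have [z xz zy] := inum_neq0P rS (TS _ uT) tS xy neq0.
    apply: (mem_cprod _ (closed_sub clT) tS (set11 r) uT xz zy xy).
    by rewrite sub1set.
  by rewrite !inum0 ?(aut_mem autf).
have rHT: cprod S [set r] H = cprod S [set r] T.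
  by apply: cond_i; rewrite inE rT.
have convH u : u \in T -> u \notin H ->
    cprod S [set conv_rel u] H = [set conv_rel u].
  move=> uT uH; apply: cond_ii.
  by rewrite inE (conv_closedE clT) (conv_closedE clH) uH.
have H_gt0: 0 < \sum_(h in H) valency h.
  rewrite (bigD1 (diag_rel X)) ?closed_diag //= addn_gt0 valency_gt0 //.
  exact: scheme_diag.
have fsT := aut_mem autf sT.
(* After multiplication by the size of an [H]-class, the two sides differ only in the valencies of
   the converses of [f s] and [s]. *)
apply/eqP; rewrite -(eqn_pmul2l H_gt0).
rewrite (inum_coset clH clT rS fsT trT rHT (convH _ fsT (aut_notin sT sH))).
rewrite (inum_coset clH clT rS sT trT rHT (convH _ sT sH)).
by rewrite -(aut_conv clT autf f1) // (aut_valency clT autf f1) // closed_conv.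
Qed.

Lemma inum_aut_l r s t : r \in T -> s \in S -> s \notin T -> t \in S ->
  inum (f r) s t = inum r s t.
Proof.
move=> rT sS sT tS; have TS := subsetP (closed_sub clT).
rewrite inum_conv ?(TS _ (aut_mem autf rT)) // -(aut_conv clT autf f1) //.
rewrite inum_aut_r ?(conv_closedE clT) ?(scheme_conv schS) //.
by rewrite -inum_conv // TS.
Qed.

Lemma inum_aut_mid r s t : r \in S -> s \in S -> s \notin T -> t \in T ->
  inum r s (f t) = inum r s t.
Proof.
move=> rS sS sT tT; have TS := subsetP (closed_sub clT).
have tS := TS _ tT; have ftS := TS _ (aut_mem autf tT).
apply/eqP; rewrite -(eqn_pmul2l (valency_gt0 tS)).
(* Only the left factor becomes the valency of [f t], so that [valency_inum] applies to [f t] on the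
   left and to [t] on the right. *)
rewrite -[X in X * _ == _](aut_valency clT autf f1 tT).
rewrite (valency_inum rS sS ftS) (valency_inum rS sS tS).
by rewrite inum_aut_l ?(conv_closedE clT) ?(scheme_conv schS).
Qed.

Lemma tilde_mem s : (tilde T f s \in T) = (s \in T).
Proof. by rewrite /tilde; case: ifP => // sT; apply: aut_mem autf _ sT. Qed.

(** Images of elements inside and outside [T] cannot collide, by [tilde_mem]; surjectivity follows
    from injectivity by finiteness. *)
Lemma tilde_sym_on : sym_on S (tilde T f).
Proof.
have inj: {in S &, injective (tilde T f)}.
  move=> s t _ _ eq_st; have := tilde_mem s; rewrite eq_st tilde_mem.
  move: eq_st; rewrite /tilde; case: ifP => sT; case: ifP => tT // eq_st _.
  exact: (autf.1.1 _ _ sT tT eq_st).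
split=> //; apply/eqP; rewrite eqEcard card_in_imset // leqnn andbT.
apply/subsetP=> _ /imsetP[s sS ->]; rewrite /tilde; case: ifP => // sT.
exact: subsetP (closed_sub clT) _ (aut_mem autf sT).
Qed.

Lemma tilde_aut : scheme_aut S (tilde T f).
Proof.
split=> [|r s t rS sS tS]; first exact: tilde_sym_on.
have tildeS u : u \in S -> tilde T f u \in S.
  by move=> uS; rewrite -tilde_sym_on.2 imset_f.
(* With exactly two of the three relations in [T], both numbers are zero, because [tilde T f]
   preserves membership in [T]. *)
have vanish: [|| [&& r \in T, s \in T & t \notin T],
    [&& r \in T, s \notin T & t \in T] | [&& r \notin T, s \in T & t \in T]] ->
    inum r s t = inum (tilde T f r) (tilde T f s) (tilde T f t).
  have inum0 a b c : a \in S -> b \in S -> c \in S ->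
      [|| [&& a \in T, b \in T & c \notin T],
        [&& a \in T, b \notin T & c \in T]
        | [&& a \notin T, b \in T & c \in T]] -> inum a b c = 0.
    move=> aS bS cS odd; apply/eqP/negPn/negP.
    case/(inum_neq0_closed clT aS bS cS).
    case/or3P: odd => /and3P[aT bT cT] abc acb bca.
    - by rewrite abc in cT.
    - by rewrite acb in bT.
    - by rewrite bca in aT.
  by move=> odd; rewrite !inum0 ?tildeS // !tilde_mem.
move: vanish; rewrite /tilde.
case: (boolP (r \in T)) => rT; case: (boolP (s \in T)) => sT;
  case: (boolP (t \in T)) => tT //= vanish; try exact: vanish.
- exact: autf.2.
- by rewrite inum_aut_l.
- by rewrite inum_aut_r.
- by rewrite inum_aut_mid.
Qed.

End Extension.

End Schemes.

Theorem theorem1p2 (X : finType) (S H T : {set {set X * X}})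
    (schS : is_scheme S)
    (clH : closed_subset S H) (clT : closed_subset S T)
    (sHT : H \subset T) (snT : strongly_normal S T)
    (cond_i : forall s, s \in S :\: T ->
       cprod S [set s] H = cprod S [set s] T)
    (cond_ii : forall t, t \in T :\: H -> cprod S [set t] H = [set t])
    (iota : {set X * X} -> {set X * X})
    (autT : scheme_aut T iota)
    (fixH : forall h, h \in H -> iota h = h) :
  scheme_aut S (tilde T iota).
Proof. exact: (tilde_aut schS clH clT sHT cond_i cond_ii autT fixH). Qed.
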